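(* Let $\mathbf{H}$ be a bicartesian closed category. Then the category $\mathbf{H}_{\pm}$ has finite products and finite coproducts.
   Context: A bicartesian closed category is a cartesian closed category with finite coproducts. Notation in $\mathbf H$: $\wedge$ for binary products, $\vee$ for binary coproducts, $\mathbf 1$ and $\mathbf 0$ for the terminal and initial objects, $\to$ for exponentials. $\mathbf{H}_{\pm}$ is the full subcategory of $\mathbf{H}\times\mathbf{H}^{\mathrm{op}}$ determined by the pairs $P=(P^+,P^-)$ of objects of $\mathbf H$ such that $P^+\wedge P^-$ is an initial object (equivalently, such that there exists a morphism $P^+\wedge P^-\to\mathbf 0$). Thus a morphism $P\to Q$ in $\mathbf{H}_{\pm}$ is a pair of morphisms $P^+\to Q^+$ and $Q^-\to P^-$ of $\mathbf H$. *)

(* Defs.v *)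
From mathcomp Require Import all_boot.
Set Implicit Arguments. Unset Strict Implicit. Unset Printing Implicit Defensive.

Declare Scope cat_scope.
Delimit Scope cat_scope with cat.
Local Open Scope cat_scope.

Record category := Category {
  obj :> Type;
  hom : obj -> obj -> Type;
  idm : forall A, hom A A;
  comp : forall A B D, hom B D -> hom A B -> hom A D;
  comp_idl : forall A B (f : hom A B), comp (idm B) f = f;
  comp_idr : forall A B (f : hom A B), comp f (idm A) = f;
  comp_assoc : forall A B D E (h : hom D E) (g : hom B D) (f : hom A B),
    comp h (comp g f) = comp (comp h g) f }.

Arguments hom {c} A B.
Arguments idm {c} A.
Arguments comp {c A B D} g f.
Notation "g \o f" := (comp g f) : cat_scope.

Definition opposite (C : category) : category :=
  @Category C (fun A B => @hom C B A) (fun A => idm A)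
    (fun A B D g f => f \o g)
    (fun A B f => comp_idr f) (fun A B f => comp_idl f)
    (fun A B D E h g f => esym (comp_assoc f g h)).

Definition product_category (C D : category) : category.
Proof.
refine (@Category (C * D)%type
  (fun X Y => (hom X.1 Y.1 * hom X.2 Y.2)%type)
  (fun X => (idm X.1, idm X.2))
  (fun X Y Z g f => (g.1 \o f.1, g.2 \o f.2)) _ _ _).
- by move=> X Y [f1 f2] /=; rewrite !comp_idl.
- by move=> X Y [f1 f2] /=; rewrite !comp_idr.
- by move=> X Y Z W [h1 h2] [g1 g2] [f1 f2] /=; rewrite !comp_assoc.
Defined.

Definition full_subcategory (C : category) (P : C -> Prop) : category :=
  @Category {X : C | P X} (fun X Y => hom (sval X) (sval Y))
    (fun X => idm (sval X)) (fun X Y Z g f => g \o f)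
    (fun X Y f => comp_idl f) (fun X Y f => comp_idr f)
    (fun X Y Z W h g f => comp_assoc h g f).

Definition is_terminal (C : category) (T : C) : Prop :=
  forall X : C, exists! f : hom X T, True.

Definition is_initial (C : category) (I : C) : Prop :=
  forall X : C, exists! f : hom I X, True.

Definition is_product (C : category) (I : Type) (X : I -> C)
    (P : C) (p : forall i, hom P (X i)) : Prop :=
  forall (Z : C) (f : forall i, hom Z (X i)),
    exists! u : hom Z P, forall i, p i \o u = f i.

Definition is_coproduct (C : category) (I : Type) (X : I -> C)
    (S : C) (s : forall i, hom (X i) S) : Prop :=
  forall (Z : C) (f : forall i, hom (X i) Z),
    exists! u : hom S Z, forall i, u \o s i = f i.

Definition has_finite_products (C : category) : Prop :=
  forall (n : nat) (X : 'I_n -> C),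
    exists (P : C) (p : forall i, hom P (X i)), is_product p.

Definition has_finite_coproducts (C : category) : Prop :=
  forall (n : nat) (X : 'I_n -> C),
    exists (S : C) (s : forall i, hom (X i) S), is_coproduct s.

(* [expo A B] is the exponential written A -> B, so [ev] is evaluation at A. *)
Record bicartesian_closed := BicartesianClosed {
  bcc_cat :> category;
  top : bcc_cat;
  topP : is_terminal top;
  bot : bcc_cat;
  botP : is_initial bot;
  meet : bcc_cat -> bcc_cat -> bcc_cat;
  pr1 : forall A B, hom (meet A B) A;
  pr2 : forall A B, hom (meet A B) B;
  pairing : forall Z A B, hom Z A -> hom Z B -> hom Z (meet A B);
  pr1_pairing : forall Z A B (f : hom Z A) (g : hom Z B),
    pr1 A B \o pairing f g = f;
  pr2_pairing : forall Z A B (f : hom Z A) (g : hom Z B),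
    pr2 A B \o pairing f g = g;
  pairing_unique : forall Z A B (f : hom Z A) (g : hom Z B)
      (u : hom Z (meet A B)),
    pr1 A B \o u = f -> pr2 A B \o u = g -> u = pairing f g;
  join : bcc_cat -> bcc_cat -> bcc_cat;
  in1 : forall A B, hom A (join A B);
  in2 : forall A B, hom B (join A B);
  copairing : forall A B Z, hom A Z -> hom B Z -> hom (join A B) Z;
  copairing_in1 : forall A B Z (f : hom A Z) (g : hom B Z),
    copairing f g \o in1 A B = f;
  copairing_in2 : forall A B Z (f : hom A Z) (g : hom B Z),
    copairing f g \o in2 A B = g;
  copairing_unique : forall A B Z (f : hom A Z) (g : hom B Z)
      (u : hom (join A B) Z),
    u \o in1 A B = f -> u \o in2 A B = g -> u = copairing f g;
  expo : bcc_cat -> bcc_cat -> bcc_cat;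
  ev : forall A B, hom (meet (expo A B) A) B;
  curry : forall Z A B, hom (meet Z A) B -> hom Z (expo A B);
  ev_curry : forall Z A B (f : hom (meet Z A) B),
    ev A B \o pairing (curry f \o pr1 Z A) (pr2 Z A) = f;
  curry_unique : forall Z A B (f : hom (meet Z A) B) (u : hom Z (expo A B)),
    ev A B \o pairing (u \o pr1 Z A) (pr2 Z A) = f -> u = curry f }.

(* The category written H_{+-}. *)
Definition signed_category (H : bicartesian_closed) : category :=
  @full_subcategory (product_category H (opposite H))
    (fun P => is_initial (meet P.1 P.2 : H)).

(* Main.v *)
Require Import Defs.
From mathcomp Require Import all_boot.

(** Products are computed as in the ambient category [H * H^op]: the terminal
object is [(1, 0)] and the product of [P] and [Q] is
[(P^+ /\ Q^+, P^- \/ Q^-)], with the universal property inherited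
componentwise because the subcategory is full.  What has to be checked is that
these pairs satisfy the defining condition.  In a cartesian closed category
every object with a map to [0] is itself initial ([initial_of_to_bot]), so it
is enough to find a map
[(P^+ /\ Q^+) /\ (P^- \/ Q^-) -> 0]; by currying this amounts to a map from
[P^- \/ Q^-] to the exponential of [0] by [P^+ /\ Q^+], that is, to one map
for each summand, and these come from [P^+ /\ P^- -> 0] and [Q^+ /\ Q^- -> 0].
Finite products of every arity then follow by induction
([finite_products_of_binary]).

Coproducts need no separate construction: exchanging the two components of a
pair is an isomorphism of the signed category with its opposite
([signed_swap]), so coproducts are products of exchanged pairs. *)

Set Implicit Arguments. Unset Strict Implicit. Unset Printing Implicit Defensive.
Local Open Scope cat_scope.

(** Families over ['I_n.+1] in a type depending on the index cannot be defined
by a plain case distinction on [i]; this packages the transport along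
[i = ord0] or [i = lift ord0 j] together with its computation rules. *)
Lemma ord_cons n (T : 'I_n.+1 -> Type) (a : T ord0)
    (b : forall j, T (lift ord0 j)) :
  {f : forall i, T i | f ord0 = a /\ forall j, f (lift ord0 j) = b j}.
Proof.
pose f i : T i := match unliftP ord0 i with
  | UnliftSome j e => eq_rect_r T (b j) e
  | UnliftNone e => eq_rect_r T a e end.
exists f; split=> [|j]; rewrite /f.
  case: unliftP => [k e|e]; first by case/eqP: (neq_lift ord0 k).
  by rewrite (eq_irrelevance e erefl).
case: unliftP => [k e|e]; last by case/eqP: (neq_lift ord0 j).
have ejk := lift_inj e; case: _ / ejk e => e.
by rewrite (eq_irrelevance e erefl).
Qed.

Definition is_binary_product (C : category) (A B P : C)
    (p : hom P A) (q : hom P B) : Prop :=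
  forall (Z : C) (f : hom Z A) (g : hom Z B),
    exists! u : hom Z P, p \o u = f /\ q \o u = g.

Lemma finite_products_of_binary (C : category) (T : C) :
    is_terminal T ->
    (forall A B : C, exists (P : C) (p : hom P A) (q : hom P B),
       is_binary_product p q) ->
  has_finite_products C.
Proof.
move=> termT binC; elim=> [|n IHn] X.
  have p (i : 'I_0) : hom T (X i) by case: i.
  exists T, p => Z f; have [u [_ uniq_u]] := termT Z.
  exists u; split=> [[] //|v _]; exact: uniq_u.
have [P' [p' prodP']] := IHn (fun j => X (lift ord0 j)).
have [P [a [b prodP]]] := binC (X ord0) P'.
have [p [p0 pS]] := @ord_cons n (fun i => hom P (X i)) a (fun j => p' j \o b).
exists P, p => Z f.
have [u' [u'P uniq_u']] := prodP' Z (fun j => f (lift ord0 j)).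
have [u [[au bu] uniq_u]] := prodP Z (f ord0) u'.
exists u; split=> [i|v vP].
  case: (unliftP ord0 i) => [j|] ->; last by rewrite p0.
  by rewrite pS -comp_assoc bu.
apply: uniq_u; split; first by rewrite -p0.
by apply/esym/uniq_u' => j; rewrite comp_assoc -pS.
Qed.

Section BicartesianClosed.

Variable H : bicartesian_closed.

Lemma bot_hom_eq (X : H) (f g : hom (bot H) X) : f = g.
Proof.
by have [u [_ uniq_u]] := @botP H X; rewrite -(uniq_u f) // -(uniq_u g).
Qed.

Lemma initial_to_bot (X : H) : is_initial X -> exists f : hom X (bot H), True.
Proof. by move/(_ (bot H)) => [f _]; exists f. Qed.

(** Maps out of [0 /\ X] correspond by currying to maps out of [0]. *)
Lemma meet_bot_hom_eq (X Y : H) (f g : hom (meet (bot H) X) Y) : f = g.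
Proof.
by rewrite -(ev_curry f) -(ev_curry g) (bot_hom_eq (curry f) (curry g)).
Qed.

(** A map [X -> 0] makes [X] a retract of [0 /\ X], from which maps are
unique. *)
Lemma initial_of_to_bot (X : H) : hom X (bot H) -> is_initial X.
Proof.
move=> t Y; have [z _] := @botP H Y.
exists (z \o t); split=> // g _.
have retr (h : hom X Y) : h = (h \o pr2 (bot H) X) \o pairing t (idm X).
  by rewrite -comp_assoc pr2_pairing comp_idr.
by rewrite (retr g) [LHS]retr (meet_bot_hom_eq (g \o _) (z \o t \o pr2 _ _)).
Qed.

Lemma meetC_initial (A B : H) : is_initial (meet A B) -> is_initial (meet B A).
Proof.
case/initial_to_bot => t _; apply: initial_of_to_bot.
exact: (t \o pairing (pr2 B A) (pr1 B A)).
Qed.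

Lemma meet_top_bot_initial : is_initial (meet (top H) (bot H)).
Proof. by apply: initial_of_to_bot; apply: pr2. Qed.

(** This is where exponentials enter: by transposition the refutation of a
coproduct is assembled from refutations of its summands. *)
Lemma meet_join_initial (A B C D : H) :
    is_initial (meet A C) -> is_initial (meet B D) ->
  is_initial (meet (meet A B) (join C D)).
Proof.
case/initial_to_bot => s _; case/initial_to_bot => t _.
apply/meetC_initial/initial_of_to_bot.
have c : hom C (expo (meet A B) (bot H)).
  by apply: curry; exact: (s \o pairing (pr1 A B \o pr2 _ _) (pr1 _ _)).
have d : hom D (expo (meet A B) (bot H)).
  by apply: curry; exact: (t \o pairing (pr2 A B \o pr2 _ _) (pr1 _ _)).
exact: (ev _ _ \o pairing (copairing c d \o pr1 _ _) (pr2 _ _)).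
Qed.

Definition signed_top : signed_category H :=
  exist _ (top H, bot H) meet_top_bot_initial.

Lemma signed_top_terminal : is_terminal signed_top.
Proof.
move=> X; have [f [_ uniq_f]] := topP (sval X).1.
have [g _] := botP (sval X).2.
exists (f, g); split=> // -[f' g'] _.
by rewrite (uniq_f f' I) (bot_hom_eq g g').
Qed.

Definition signed_meet (P Q : signed_category H) : signed_category H :=
  exist _ (meet (sval P).1 (sval Q).1, join (sval P).2 (sval Q).2)
    (meet_join_initial (svalP P) (svalP Q)).

Definition signed_pr1 P Q : hom (signed_meet P Q) P := (pr1 _ _, in1 _ _).
Definition signed_pr2 P Q : hom (signed_meet P Q) Q := (pr2 _ _, in2 _ _).

Lemma signed_meet_product (P Q : signed_category H) :
  is_binary_product (signed_pr1 P Q) (signed_pr2 P Q).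
Proof.
move=> Z [f1 f2] [g1 g2].
exists (pairing f1 g1, copairing f2 g2); split=> [|[u1 u2] /= [[p1 i1] [p2 i2]]].
  by rewrite /= pr1_pairing pr2_pairing copairing_in1 copairing_in2.
by rewrite (pairing_unique p1 p2) (copairing_unique i1 i2).
Qed.

Lemma signed_finite_products : has_finite_products (signed_category H).
Proof.
apply: (finite_products_of_binary signed_top_terminal) => P Q.
exists (signed_meet P Q), (signed_pr1 P Q), (signed_pr2 P Q).
exact: signed_meet_product.
Qed.

Definition signed_swap (P : signed_category H) : signed_category H :=
  exist _ ((sval P).2, (sval P).1) (meetC_initial (svalP P)).

Definition swap_hom P Q (f : hom P Q) : hom (signed_swap Q) (signed_swap P) :=
  (f.2, f.1).

Lemma signed_finite_coproducts : has_finite_coproducts (signed_category H).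
Proof.
move=> n X.
have [P [p prodP]] := signed_finite_products (fun i => signed_swap (X i)).
(* The double exchange of [X i] agrees with [X i] up to conversion of homs. *)
exists (signed_swap P), (fun i => swap_hom (p i)) => Z f.
have [u [uP uniq_u]] := prodP (signed_swap Z) (fun i => swap_hom (f i)).
exists (swap_hom u); split=> [i|[v1 v2] vP].
  by apply: etrans (congr1 (@swap_hom _ _) (uP i)) _; case: (f i).
have uv : u = (v2, v1) by apply: uniq_u => i; rewrite -(vP i).
by rewrite uv.
Qed.

End BicartesianClosed.

Theorem lemma3p4 (H : bicartesian_closed) :
  has_finite_products (signed_category H) /\
  has_finite_coproducts (signed_category H).
Proof.
split; [exact: signed_finite_products | exact: signed_finite_coproducts].
Qed.
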